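(* For any graph $G$ with no isolated vertex, $$\gamma_{oitR}(G)\leq \min\{\gamma_{t,oi}(G),\gamma_{oiR}(G)\}+\gamma(G).$$
   Context: All graphs are finite, undirected and simple (no loops or multiple edges). $\gamma(G)$ is the domination number: the minimum cardinality of a set $D\subseteq V(G)$ such that every vertex in $V(G)\setminus D$ has a neighbor in $D$. A total dominating set is a set $D\subseteq V(G)$ such that every vertex in $V(G)$ has a neighbor in $D$. A total dominating set $D$ is an outer-independent total dominating set if $V(G)\setminus D$ is an independent set; $\gamma_{t,oi}(G)$ is the minimum cardinality of such a set. For a function $f:V(G)\to\{0,1,2\}$, let $V_i=\{v\in V(G): f(v)=i\}$ for $i\in\{0,1,2\}$; the weight of $f$ is $\omega(f)=\sum_{v\in V(G)}f(v)$. The function $f$ is an outer-independent Roman dominating function if every vertex in $V_0$ is adjacent to at least one vertex in $V_2$ and $V_0$ is an independent set; $\gamma_{oiR}(G)$ is the minimum weight of such a function. The function $f$ (on a graph with no isolated vertex) is an outer-independent total Roman dominating function if, in addition, the subgraph induced by $V_1\cup V_2$ has no isolated vertex; $\gamma_{oitR}(G)$ is the minimum weight of such a function. *)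

(* Defs.v *)
From mathcomp Require Import all_boot.

Set Implicit Arguments.
Unset Strict Implicit.
Unset Printing Implicit Defensive.

Section Domination.

(* The edge relation of a graph on the vertex set T; the statement requires
   it to be symmetric and irreflexive. *)
Variables (T : finType) (e : rel T).

Definition independent (A : {set T}) : bool :=
  [forall u in A, forall v in A, ~~ e u v].

(* The subgraph induced by A has no isolated vertex. *)
Definition no_isolated_in (A : {set T}) : bool :=
  [forall v in A, exists u in A, e v u].

Definition no_isolated : bool := no_isolated_in [set: T].

Definition dominating (D : {set T}) : bool :=
  [forall v in ~: D, exists u in D, e v u].

Definition total_dominating (D : {set T}) : bool :=
  [forall v, exists u in D, e v u].

Definition oi_total_dominating (D : {set T}) : bool :=
  total_dominating D && independent (~: D).

Definition level (f : {ffun T -> 'I_3}) (i : nat) : {set T} :=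
  [set v | f v == i :> nat].

Definition weight (f : {ffun T -> 'I_3}) : nat := \sum_(v : T) f v.

Definition oi_Roman (f : {ffun T -> 'I_3}) : bool :=
  [forall v in level f 0, exists u in level f 2, e v u]
  && independent (level f 0).

Definition oi_total_Roman (f : {ffun T -> 'I_3}) : bool :=
  oi_Roman f && no_isolated_in (level f 1 :|: level f 2).

(* [arg min_(x < x0 | P x) F x] is a minimiser of F over P only when P x0
   holds. Here x0 is [set: T] or the constant function 1; the lemmas below
   check P x0, for the total variants under no_isolated. *)
Definition min_card (P : pred {set T}) : nat :=
  #|[arg min_(D < [set: T] | P D) #|D|]|.

Definition one_fun : {ffun T -> 'I_3} := [ffun=> inord 1].

Definition min_weight (P : pred {ffun T -> 'I_3}) : nat :=
  weight [arg min_(f < one_fun | P f) weight f].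

Definition gamma : nat := min_card dominating.
Definition gamma_toi : nat := min_card oi_total_dominating.
Definition gamma_oiR : nat := min_weight oi_Roman.
Definition gamma_oitR : nat := min_weight oi_total_Roman.

Lemma min_cardP (P : pred {set T}) : P [set: T] ->
  (exists2 D, P D & #|D| = min_card P) /\ (forall D, P D -> min_card P <= #|D|).
Proof.
rewrite /min_card => PT; case: arg_minnP => // D PD minD.
by split; first exists D.
Qed.

Lemma min_weightP (P : pred {ffun T -> 'I_3}) : P one_fun ->
  (exists2 f, P f & weight f = min_weight P)
  /\ (forall f, P f -> min_weight P <= weight f).
Proof.
rewrite /min_weight => P1; case: arg_minnP => // f Pf minf.
by split; first exists f.
Qed.

Lemma dominating_setT : dominating [set: T].
Proof. by apply/forall_inP => v; rewrite !inE. Qed.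

Lemma oi_total_dominating_setT : no_isolated -> oi_total_dominating [set: T].
Proof.
move=> /forall_inP niso; apply/andP; split.
  by apply/forallP => v; apply: niso; rewrite inE.
by apply/forall_inP => v; rewrite !inE.
Qed.

Lemma level_one_fun i : level one_fun i = if i == 1 then [set: T] else set0.
Proof.
by apply/setP => v; rewrite inE ffunE inordK // eq_sym; case: (i == 1); rewrite inE.
Qed.

Lemma oi_Roman_one_fun : oi_Roman one_fun.
Proof.
rewrite /oi_Roman !level_one_fun /=.
by apply/andP; split; apply/forall_inP => v; rewrite inE.
Qed.

Lemma oi_total_Roman_one_fun : no_isolated -> oi_total_Roman one_fun.
Proof. by rewrite /oi_total_Roman oi_Roman_one_fun !level_one_fun /= setU0. Qed.

End Domination.

(* Main.v *)
Require Import Defs.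
From mathcomp Require Import all_boot.

(** Let [S] be a minimum dominating set. If [D] is an outer-independent total
    dominating set, the sum of the indicators of [D] and [S] works: a vertex of
    value 0 has a neighbour in [S], which lies in [D] because the complement of
    [D] is independent. If [g] is an outer-independent Roman dominating
    function, each [s] in [S] adds at most one unit of weight: it raises itself
    to 1 when [g s = 0], and otherwise raises one chosen neighbour to at
    least 1. *)

Section OuterIndependent.

Local Set Implicit Arguments.
Local Unset Strict Implicit.

Variables (T : finType) (e : rel T).
Implicit Types (D S : {set T}) (f g : {ffun T -> 'I_3}).

Lemma sum_nat_in D : \sum_(v : T) (v \in D : nat) = #|D|.
Proof. by rewrite -sum1_card [RHS]big_mkcond; apply: eq_bigr => v _; case: ifP. Qed.

(** As values lie in ['I_3], the union of levels 1 and 2 is the set of vertices of positive value,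
    so every condition can be tested on values alone. *)
Lemma oi_total_RomanI f :
    (forall v, f v = 0 :> nat -> exists2 u, f u = 2 :> nat & e v u) ->
    (forall u v, f u = 0 :> nat -> f v = 0 :> nat -> ~~ e u v) ->
    (forall v, 0 < f v -> exists2 u, 0 < f u & e v u) ->
  oi_total_Roman e f.
Proof.
move=> dom0 ind0 nis.
have posE v : (v \in level f 1 :|: level f 2) = (0 < f v).
  by rewrite !inE; case: (f v) => [[|[|[|]]]].
apply/andP; split; first (apply/andP; split).
- apply/forall_inP => v; rewrite inE => /eqP /dom0 [u fu evu].
  by apply/exists_inP; exists u; rewrite // inE fu.
- apply/forall_inP => u; rewrite inE => /eqP fu.
  by apply/forall_inP => v; rewrite inE => /eqP; apply: ind0.
- apply/forall_inP => v; rewrite posE => /nis [u fu evu].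
  by apply/exists_inP; exists u; rewrite ?posE.
Qed.

Lemma independentP D :
  reflect (forall u v, u \in D -> v \in D -> ~~ e u v) (independent e D).
Proof.
apply: (iffP forall_inP) => [ind u v uD | ind u uD].
  exact: (forall_inP (ind u uD)).
by apply/forall_inP => v; apply: ind.
Qed.

Lemma dominatingP D :
  reflect (forall v, v \notin D -> exists2 u, u \in D & e v u) (dominating e D).
Proof.
apply: (iffP forall_inP) => dom v vD; first by apply/exists_inP/dom; rewrite inE.
by apply/exists_inP/dom; rewrite inE in vD.
Qed.

Lemma oitR_of_oi_total_dominating D S :
    oi_total_dominating e D -> dominating e S ->
  exists2 f, oi_total_Roman e f & weight f = #|D| + #|S|.
Proof.
case/andP=> /forallP totD /independentP indD /dominatingP domS.
pose f : {ffun T -> 'I_3} := [ffun v => inord ((v \in D) + (v \in S))].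
have fE v : f v = (v \in D) + (v \in S) :> nat.
  by rewrite ffunE inordK //; case: (v \in D); case: (v \in S).
have f0 v : f v = 0 :> nat -> v \notin D /\ v \notin S.
  by rewrite fE; case: (v \in D); case: (v \in S).
exists f; last first.
  by rewrite /weight -!sum_nat_in -big_split; apply: eq_bigr => v _; apply: fE.
apply: oi_total_RomanI => [v /f0 [vD vS] | u v /f0 [uD _] /f0 [vD _] | v _].
- have [u uS evu] := domS v vS; exists u => //.
  have uD : u \in D by apply: contraTT evu => uD; apply: indD; rewrite inE.
  by rewrite fE uD uS.
- by apply: indD; rewrite inE.
(* Every vertex has a neighbour in [D], where [f] is at least 1. *)
- have /exists_inP [u uD evu] := totD v.
  by exists u; rewrite // fE uD.
Qed.

Lemma oitR_of_oi_Roman g S :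
    no_isolated e -> oi_Roman e g -> dominating e S ->
  exists2 f, oi_total_Roman e f & weight f <= weight g + #|S|.
Proof.
move=> /forall_inP niso /andP [/forall_inP domg /independentP indg].
move=> /dominatingP domS.
(* [h s] is the vertex that [s] raises. The default of [odflt] is never reached, since no vertex is
   isolated. *)
pose h v := if g v == 0 :> nat then v else odflt v [pick u | e v u].
have hE v : 0 < g v -> e v (h v).
  rewrite /h lt0n => /negbTE ->; case: pickP => // iso.
  by have /exists_inP [u _] := niso v (in_setT v); rewrite iso.
(* A maximum, unlike a sum, stays within ['I_3] where [g] is already 2. *)
pose f : {ffun T -> 'I_3} := [ffun v => inord (maxn (g v) (v \in h @: S))].
have fE v : f v = maxn (g v) (v \in h @: S) :> nat.
  by rewrite ffunE inordK // gtn_max ltn_ord; case: (v \in _).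
have le_gf v : g v <= f v by rewrite fE leq_maxl.
have f_h s : s \in S -> 0 < f (h s).
  by move=> sS; rewrite fE imset_f // leq_maxr.
have domg2 v : g v = 0 :> nat -> exists2 u, g u = 2 :> nat & e v u.
  move=> gv; have /domg/exists_inP [u] : v \in level g 0 by rewrite inE gv.
  by rewrite inE => /eqP; exists u.
(* Values only grow, so the zero set of [f] inherits independence and domination from that of
   [g]. *)
have f0 v : f v = 0 :> nat -> g v = 0 :> nat.
  by move=> fv; have := le_gf v; rewrite fv leqn0 => /eqP.
exists f; last first.
  apply: (@leq_trans (weight g + #|h @: S|)); last first.
    by rewrite leq_add2l leq_imset_card.
  rewrite /weight -sum_nat_in -big_split; apply: leq_sum => v _.
  by rewrite fE geq_max leq_addr leq_addl.
apply: oi_total_RomanI => [v /f0 /domg2 [u gu evu] | u v /f0 gu /f0 gv | v _].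
- exists u => //; apply/eqP; rewrite eqn_leq -ltnS ltn_ord /=.
  by have := le_gf u; rewrite gu.
- by apply: indg; rewrite inE ?gu ?gv.
(* If [g v = 0], a neighbour has value 2. Otherwise, if [v] is in [S], the neighbour [h v] was
   raised; if not, a neighbour [u] in [S] is positive under [g] or raised itself, as then
   [h u = u]. *)
- have [gv | gv] := posnP (g v).
    have [u gu evu] := domg2 v gv.
    by exists u => //; apply: leq_trans (le_gf u); rewrite gu.
  have [vS | /domS [u uS evu]] := boolP (v \in S).
    by exists (h v); [apply: f_h | apply: hE].
  exists u => //; have [gu | gu] := posnP (g u).
    by have := f_h u uS; rewrite /h gu.
  exact: leq_trans (le_gf u).
Qed.

End OuterIndependent.

Theorem theorem2p8 (T : finType) (e : rel T)
    (e_sym : symmetric e) (e_irr : irreflexive e) (niso : no_isolated e) :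
  gamma_oitR e <= minn (gamma_toi e) (gamma_oiR e) + gamma e.
Proof.
have [_ min_oitR] := min_weightP (oi_total_Roman_one_fun niso).
have [[S domS cardS] _] := min_cardP (dominating_setT e).
have [[D toiD cardD] _] := min_cardP (oi_total_dominating_setT niso).
have [[g oiRg wg] _] := min_weightP (oi_Roman_one_fun e).
rewrite addn_minl leq_min /gamma_toi /gamma_oiR /gamma -cardS -cardD -wg.
apply/andP; split.
  by have [f /min_oitR le_f <-] := oitR_of_oi_total_dominating toiD domS.
have [f /min_oitR le_f] := oitR_of_oi_Roman niso oiRg domS.
exact: leq_trans.
Qed.
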